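(* Let $L$ be a solvable infinite filiform Lie algebra over $\mathbb{C}$. Then there are unique integers $r,s$ with $1\le r<s$, $s\ne 2r$, and complex numbers $\lambda_t$ ($t>s$, $t\ne 2r$) such that $L$ is isomorphic to the infinite filiform Lie algebra given by the equations \begin{align*} [a,e_i]&=e_{i+1}\quad\text{for } i\ge 1,\\ [e_1,e_i]&=e_{1+i+r}+e_{1+i+s}+\sum_{t>s,\ t\ne 2r}\lambda_t\,e_{1+i+t}\quad\text{for } i\ge 2,\\ [e_i,e_j]&=0\quad\text{for } i,j\ge 2. \end{align*}
   Context: Here infinite sums of basis elements are allowed: an infinite filiform Lie algebra over $\mathbb{C}$ is a Lie algebra $L$ whose underlying vector space consists of all formal series $\alpha a+\sum_{i\ge 1}\beta_i e_i$ ($\alpha,\beta_i\in\mathbb{C}$), so that $a,e_1,e_2,\ldots$ is a topological basis, with a bracket that is compatible with infinite sums (i.e. continuous for the product topology, where each coordinate copy of $\mathbb{C}$ is discrete), such that for all $j\ge 1$ $$[a,e_j]=e_{j+1}\quad\text{and}\quad [e_j,e_{j+1}]=\sum_{s\ge 1}\lambda_{js}\,e_{2j+1+s}$$ for some constants $\lambda_{js}\in\mathbb{C}$. The algebra given by the equations in the claim is the one of this form whose bracket is determined on the topological basis by these equations (together with antisymmetry) and extended by bilinearity and continuity. Isomorphism means isomorphism of Lie algebras.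
   Formalization: The claim fails for algebras isomorphic to [a,e_i]=e_{i+1}, [e_1,e_i]=c e_{1+i+r} (i≥2), [e_i,e_j]=0 (i,j≥2), with r≥1 and c complex (c=0 allowed): they have no such normal form, so they are excluded. Uniqueness is asserted for r,s only. *)

(* Defs.v *)
From HB Require Import structures.
From mathcomp Require Import all_boot all_order all_algebra.
From mathcomp Require Import sesquilinear complex.
From mathcomp Require Import all_classical all_reals topology.

Set Implicit Arguments.
Unset Strict Implicit.
Unset Printing Implicit Defensive.

Import GRing.Theory.
Local Open Scope classical_set_scope.
Local Open Scope ring_scope.

Section LieAlgebra.
Context {K : fieldType} {V : lmodType K}.
Implicit Types (A : set V).

Definition alternating (br : V -> V -> V) : Prop := forall x, br x x = 0.

Definition jacobi (br : V -> V -> V) : Prop :=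
  forall x y z, br x (br y z) + br y (br z x) + br z (br x y) = 0.

Definition linear_subspace A : Prop :=
  A 0 /\ forall k x y, A x -> A y -> A (k *: x + y).

(* Purely algebraic derived series: the span of the brackets is not closed up
   for any topology on V. *)
Fixpoint derived_series (br : V -> V -> V) (n : nat) : set V :=
  if n is m.+1 then
    smallest linear_subspace
      [set br x y | x in derived_series br m & y in derived_series br m]
  else setT.

Definition lie_solvable (br : V -> V -> V) : Prop :=
  exists n, derived_series br n = [set 0].

End LieAlgebra.

Definition lie_isomorphic (K : fieldType) (V W : lmodType K)
    (brV : V -> V -> V) (brW : W -> W -> W) : Prop :=
  exists f : {linear V -> W},
    bijective f /\ forall x y, f (brV x y) = brW (f x) (f y).

(* The formal series alpha a + sum_(i >= 1) beta_i e_i, as the sequence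
   (alpha, beta_1, beta_2, ...) of its coefficients: index 0 is that of a. *)
Definition formal (K : Type) : Type := {ptws nat -> discrete_topology K}.

HB.instance Definition _ (K : fieldType) :=
  Topological.copy (formal K) {ptws nat -> discrete_topology K}.
HB.instance Definition _ (K : fieldType) :=
  GRing.Lmodule.copy (formal K) (nat -> K^o).

Section Basis.
Context {K : fieldType}.

Definition avec : formal K := fun k => (k == 0)%:R.

(* Only meant for i >= 1. *)
Definition evec (i : nat) : formal K := fun k => (k == i)%:R.

(* The formal series sum_(t >= 1) c_t e_(m + t). *)
Definition eseries (m : nat) (c : nat -> K) : formal K :=
  fun k => if (m < k)%N then c (k - m)%N else 0.

End Basis.

Record infFiliform (K : fieldType) := InfFiliform {
  filbr :> {bilinear formal K -> formal K -> formal K};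
  filbr_alternating : alternating filbr;
  filbr_jacobi : jacobi filbr;
  filbr_continuous :
    continuous (fun p : formal K * formal K => filbr p.1 p.2);
  filbr_a : forall j, (1 <= j)%N -> filbr avec (evec j) = evec j.+1;
  filbr_e : exists lam : nat -> nat -> K, forall j, (1 <= j)%N ->
    filbr (evec j) (evec j.+1) = eseries (2 * j + 1) (lam j)
}.

Section NormalForm.
Context {K : fieldType}.
Implicit Types M : infFiliform K.

(* As the bracket of M is bilinear, alternating and continuous, each of the two
   systems of equations below determines M. *)
Definition normal_form M (r s : nat) (lam : nat -> K) : Prop :=
  [/\ forall i, (1 <= i)%N -> M avec (evec i) = evec i.+1,
      forall i, (2 <= i)%N -> M (evec 1) (evec i) =
        evec (1 + i + r) + evec (1 + i + s) +
        eseries (1 + i)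
          (fun t => if (s < t)%N && (t != 2 * r)%N then lam t else 0)
    & forall i j, (2 <= i)%N -> (2 <= j)%N -> M (evec i) (evec j) = 0].

Definition monomial_form M (r : nat) (c : K) : Prop :=
  [/\ forall i, (1 <= i)%N -> M avec (evec i) = evec i.+1,
      forall i, (2 <= i)%N -> M (evec 1) (evec i) = c *: evec (1 + i + r)
    & forall i j, (2 <= i)%N -> (2 <= j)%N -> M (evec i) (evec j) = 0].

(* These algebras have no normal form: [e_1, e_i] has no second leading term
   when c <> 0 (c can then be scaled to 1) and vanishes when c = 0. *)
Definition monomial_type (L : infFiliform K) : Prop :=
  exists r c M, [/\ (1 <= r)%N, monomial_form M r c & lie_isomorphic L M].

End NormalForm.

(* Main.v *)
(* The last nonzero term of the derived series is an abelian ideal; by continuity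
   its closure, which contains all series in e_k, e_(k+1), ... for some k, is
   abelian as well, and the Jacobi identity pushes k down to 2. On the abelian
   ideal spanned by e_2, e_3, ... let T be the action of a; then e_1 acts as a
   power series phi(T) = sum_t c_t T^(t+1), so that L is determined by phi.
   An isomorphism sends a to al a + be e_1 and e_1 to ga e_1, modulo that ideal,
   and exists exactly when ga psi(T) = phi(al T + be psi(T)). If c_r is the first
   nonzero coefficient, be changes first the coefficient of index 2r, by a nonzero
   multiple of be, and so kills it for exactly one value of be; al and ga then
   scale two nonzero coefficients to 1. Between two normal forms be is 0, and the
   scalings preserve the indices of the nonzero coefficients. *)
Require Import Defs.
From HB Require Import structures.
From mathcomp Require Import all_boot all_order all_algebra.
From mathcomp Require Import sesquilinear complex.
From mathcomp Require Import all_classical all_reals topology.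
From mathcomp Require Import zify ring.

Set Implicit Arguments.
Unset Strict Implicit.
Unset Printing Implicit Defensive.

Import Order.TTheory GRing.Theory.
Local Open Scope classical_set_scope.
Local Open Scope ring_scope.

(** * Coordinates, filtration and topology of formal series *)

Section Formal.
Context {K : fieldType}.
Implicit Types (x y z : formal K) (i j k m n : nat).
Local Notation e := (@evec K).

Lemma formalD x y k : (x + y) k = x k + y k :> K.
Proof. by []. Qed.

Lemma formalZ (c : K) x k : (c *: x) k = c * x k :> K.
Proof. by []. Qed.

Lemma formalN x k : (- x) k = - x k :> K.
Proof. by []. Qed.

Lemma formal0 k : (0 : formal K) k = 0 :> K.
Proof. by []. Qed.

Lemma formal_sum (I : Type) (s : seq I) (P : pred I) (F : I -> formal K) k :
  (\sum_(i <- s | P i) F i) k = \sum_(i <- s | P i) F i k :> K.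
Proof. by elim/big_rec2: _ => // i y1 y2 _ <-. Qed.

Definition formalE := (formal0, formalD, formalZ, formalN, formal_sum).

Lemma evecE i k : e i k = (k == i)%:R :> K.
Proof. by []. Qed.

Lemma formalP x y : (forall k, x k = y k) -> x = y.
Proof. by move=> ?; apply/funext. Qed.

Lemma formal_cvgP (F : set_system (formal K)) x : Filter F ->
  (F --> x) <-> (forall k, \forall y \near F, y k = x k :> K).
Proof.
move=> FF.
have := @pointwise_cvgP nat (discrete_topology K) F x FF.
move=> [H1 H2]; split=> [Fx k|H].
  by have /discrete_cvg := H1 Fx k; apply.
apply: H2 => k; apply/discrete_cvg; exact: H.
Qed.

(* Membership in the closed span of the [e k] with [n <= k]; here and below the
   basis vector [a] is [e 0], as [evec 0] is convertible to [avec]. *)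
Definition fil n x : bool := all (fun k => (x k : K) == 0) (iota 0 n).

Lemma filP n x : reflect (forall k, (k < n)%N -> x k = 0 :> K) (fil n x).
Proof.
apply: (iffP allP) => [h k kn|h k]; first by apply/eqP/h; rewrite mem_iota.
by rewrite mem_iota => /h /eqP.
Qed.

Lemma fil_coord n x k : fil n x -> (k < n)%N -> x k = 0 :> K.
Proof. by move/filP; apply. Qed.

Lemma filW m n x : (m <= n)%N -> fil n x -> fil m x.
Proof.
by move=> mn xn; apply/filP => k km; apply: (fil_coord xn); apply: leq_trans mn.
Qed.

Lemma filD n x y : fil n x -> fil n y -> fil n (x + y).
Proof.
by move=> hx hy; apply/filP => k kn; rewrite formalE !(fil_coord _ kn) ?addr0.
Qed.

Lemma filZ n (c : K) x : fil n x -> fil n (c *: x).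
Proof. by move=> hx; apply/filP => k kn; rewrite formalE (fil_coord hx) ?mulr0. Qed.

Lemma filN n x : fil n x -> fil n (- x).
Proof. by rewrite -scaleN1r; exact: filZ. Qed.

Lemma filB n x y : fil n x -> fil n y -> fil n (x - y).
Proof. by move=> hx hy; apply: filD => //; apply: filN. Qed.

Lemma fil0 n : fil n (0 : formal K).
Proof. exact/filP. Qed.

Lemma fil_evec n i : (n <= i)%N -> fil n (e i).
Proof. by move=> ni; apply/filP => k kn; rewrite evecE ltn_eqF // (leq_trans kn). Qed.

Lemma fil_eseries n m (c : nat -> K) : (n <= m.+1)%N -> fil n (eseries m c).
Proof.
by move=> nm; apply/filP => k kn; rewrite /eseries ltnNge -ltnS (leq_trans kn nm).
Qed.

Lemma eseriesE m (c : nat -> K) s :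
  eseries m c (m + s)%N = if (0 < s)%N then c s else 0 :> K.
Proof. by rewrite /eseries addKn -[X in (X < _)%N]addn0 ltn_add2l. Qed.

Lemma fil_eqP x : (forall n, fil n x) -> x = 0.
Proof. by move=> h; apply: formalP => k; exact: fil_coord (h k.+1) (ltnSn k). Qed.

Lemma nbhs_fil x n : \forall y \near x, fil n (y - x).
Proof.
have H : forall k, \forall y \near x, y k = x k :> K.
  by apply: (@formal_cvgP (nbhs x) x _).1; exact: cvg_id.
elim: n => [|n IH]; first by apply: filterE => y.
near=> y; apply/filP => k; rewrite ltnS leq_eqVlt => /orP[/eqP->|]; last first.
  by apply/fil_coord; near: y; exact: IH.
by rewrite formalE formalN; apply/eqP; rewrite subr_eq0; apply/eqP; near: y; exact: H.
Unshelve. all: by end_near. Qed.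

(* If no basic neighbourhood of [x] is inside [A], points of the complement of
   [A] form a sequence converging coordinatewise to [x]. *)
Lemma nbhs_formalP x (A : set (formal K)) :
  nbhs x A <-> exists n, forall y, fil n (y - x) -> A y.
Proof.
split=> [xA|[n An]]; last by apply: filterS (nbhs_fil x n) => y; exact: An.
apply: contrapT => /forallNP H.
have /choice[u uP] : forall n, exists y, fil n (y - x) /\ ~ A y.
  by move=> n; have /existsNP[y /not_implyP] := H n; exists y.
have ux : u @ \oo --> x.
  apply/formal_cvgP => k; exists k.+1 => // n /= kn.
  by apply/eqP; rewrite -subr_eq0 -formalN -formalD (fil_coord (proj1 (uP n))).
have [n _ /(_ n (leqnn n)) /=] := ux _ xA.
exact: (proj2 (uP n)).
Qed.

Lemma continuous_formalP (T : topologicalType) (f : T -> formal K) :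
  continuous f <-> forall t k, \forall s \near t, f s k = f t k :> K.
Proof.
by split=> H t; [apply: (@formal_cvgP (f @ t) (f t) _).1|
  apply: (@formal_cvgP (f @ t) (f t) _).2]; exact: H.
Qed.

Definition trunc n x : formal K := \sum_(i < n) x i *: e i.

Lemma truncE n x k : trunc n x k = if (k < n)%N then x k else 0 :> K.
Proof.
rewrite /trunc formalE; case: ifP => kn.
  rewrite (bigD1 (Ordinal kn)) //= formalE evecE eqxx mulr1 big1 ?addr0 // => i ik.
  rewrite formalE evecE; case: eqP => [ki|]; last by rewrite mulr0.
  by case/eqP: ik; apply: val_inj.
rewrite big1 // => i _; rewrite formalE evecE; case: eqP => [ki|]; rewrite ?mulr0 //.
by move: kn; rewrite ki ltn_ord.
Qed.

Lemma fil_trunc n x : fil n (x - trunc n x).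
Proof. by apply/filP => k kn; rewrite !formalE truncE kn subrr. Qed.

Section LinearMaps.
Variable f : {linear formal K -> formal K}.

(** Continuity at 0 in finite terms: each coordinate of the image depends on finitely many
    coordinates of the argument, so [f] is a matrix with finite rows. *)
Definition local_map := forall k, exists n, forall x, fil n x -> f x k = 0 :> K.

Lemma local_continuous : local_map -> continuous f.
Proof.
move=> H; apply/continuous_formalP => x k; have [n nP] := H k.
apply/nbhs_formalP; exists n => y /nP; rewrite linearB formalE formalN.
by move/eqP; rewrite subr_eq0 => /eqP.
Qed.

Hypothesis f_loc : local_map.

Lemma local_coord n x k : (forall j, (n <= j)%N -> f (e j) k = 0 :> K) ->
  f x k = \sum_(j < n) x j * f (e j) k :> K.
Proof.
move=> fn; have [m mP] := f_loc k; pose p := maxn m n.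
rewrite -[x in LHS](subrK (trunc p x)) linearD formalE mP; last first.
  exact: filW (leq_maxl m n) (fil_trunc p x).
rewrite add0r /trunc linear_sum formalE.
rewrite (big_ord_widen p (fun j => x j * f (e j) k)) ?leq_maxr //.
rewrite [RHS]big_mkcond; apply: eq_bigr => i _; rewrite linearZ /= formalE.
by case: ifP => // /negbT; rewrite -leqNgt => /fn ->; rewrite mulr0.
Qed.

Lemma local_fil m n : (forall j, (m <= j)%N -> fil n (f (e j))) ->
  forall x, fil m x -> fil n (f x).
Proof.
move=> H x mx; apply/filP => k kn; rewrite (@local_coord m); last first.
  by move=> j mj; exact: fil_coord (H j mj) kn.
by rewrite big1 // => i _; rewrite (fil_coord mx) // mul0r.
Qed.

End LinearMaps.

End Formal.
Arguments fil {K}.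

Section LocalSeries.
Context {K : fieldType}.

(** Evaluates a double bracket as a convolution. The series [c s] may vary with [s], since the
    coefficients of [[e_h, e_j]] depend on [j]. *)
Lemma local_eseries (f : {linear formal K -> formal K}) (m m' : nat)
    (c : nat -> nat -> K) (l : nat -> K) n : local_map f ->
  (forall s, (0 < s)%N -> f (evec (m + s)) = eseries (m' + s) (c s)) ->
  (0 < n)%N ->
  f (eseries m l) (m' + n)%N = \sum_(1 <= s < n) l s * c s (n - s)%N :> K.
Proof.
move=> f_loc fe n0; rewrite (local_coord f_loc (n := m + n)); last first.
  move=> j mnj; rewrite -(subnKC (leq_trans (leq_addr n m) mnj)) fe; last first.
    by rewrite subn_gt0 (leq_trans _ mnj) // -addn1 leq_add2l.
  by rewrite /eseries ltn_add2l ltnNge leq_subRL ?mnj // (leq_trans _ mnj) ?leq_addr.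
rewrite big_split_ord /= big1 ?add0r => [|i _]; last first.
  by rewrite /eseries ltnNge ltnW // mul0r.
rewrite -(big_mkord xpredT
  (fun i => eseries m l (m + i) * f (evec (m + i)) (m' + n)%N : K)).
rewrite big_ltn // eseriesE ltnn mul0r add0r.
apply: eq_big_nat => s /andP[s0 sn]; rewrite fe // eseriesE s0 /eseries ltn_add2l sn.
by rewrite subnDl.
Qed.
End LocalSeries.

(** * Bracket computations, and lowering the start of the abelian tail to 2 *)

Section Bracket.
Context {K : fieldType}.
Variable L : infFiliform K.
Implicit Types (x y z : formal K) (i j k m n : nat).
Local Notation e := (@evec K).

Lemma br_self x : L x x = 0. Proof. exact: filbr_alternating. Qed.

Lemma br_anti x y : L x y = - L y x.
Proof.
apply/eqP; rewrite -addr_eq0; apply/eqP.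
by have := br_self (x + y); rewrite linearDl !linearDr !br_self add0r addr0.
Qed.

Lemma br_deriv x y z : L x (L y z) = L (L x y) z + L y (L x z).
Proof.
have := filbr_jacobi L x y z; rewrite (br_anti z x) (br_anti z) linearNr.
by move/eqP; rewrite -addrA addr_eq0 opprD !opprK addrC => /eqP.
Qed.

Lemma br_near x y k : exists n, forall x' y', fil n (x' - x) -> fil n (y' - y) ->
  L x' y' k = L x y k :> K.
Proof.
have /continuous_formalP/(_ (x, y) k) := @filbr_continuous K L.
case=> -[A B] [/= /nbhs_formalP[n nA] /nbhs_formalP[m mB]] AB.
exists (maxn n m) => x' y' xx yy; apply: (AB (x', y')); split=> /=.
  by apply: nA; apply: filW xx; rewrite leq_maxl.
by apply: mB; apply: filW yy; rewrite leq_maxr.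
Qed.

Lemma br_local x : local_map (L x).
Proof.
move=> k; have [n nP] := br_near x 0 k; exists n => y yn.
by rewrite /= nP ?subrr ?subr0 ?fil0 // linear0r.
Qed.

Lemma br_a j : (0 < j)%N -> L (e 0) (e j) = e j.+1.
Proof. exact: filbr_a. Qed.

Lemma br_aE x k : L (e 0) x k = if (1 < k)%N then x k.-1 else 0 :> K.
Proof.
rewrite (local_coord (br_local (e 0)) (n := k)) => [|[|j]]; last first.
- by move=> kj; rewrite /= br_a // evecE ltn_eqF // ltnS.
- by rewrite /= br_self.
case: k => [|[|k]] /=; first by rewrite big_ord0.
  by rewrite big_ord1 br_self mulr0.
rewrite big_ord_recr /= br_a // evecE eqxx mulr1 big1 ?add0r // => -[[|j] jk] _ /=.
  by rewrite br_self mulr0.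
by rewrite br_a // evecE [_ == _]gtn_eqF ?mulr0 // ltnS.
Qed.

Lemma fil_br_a n x : fil n.+1 x -> fil n.+2 (L (e 0) x).
Proof.
move=> xn; apply/filP => -[|k] kn; rewrite br_aE //.
by case: ifP => // _; apply: fil_coord xn _.
Qed.

Lemma fil2_br_a x : fil 2 (L (e 0) x).
Proof. by apply/filP => k k2; rewrite br_aE ltnNge -ltnS k2. Qed.

Lemma br_a_eseries m c : L (e 0) (eseries m c) = eseries m.+1 c.
Proof.
by apply: formalP => k; rewrite br_aE /eseries; case: k => [|[|k]].
Qed.

Lemma br_ee j : (0 < j)%N -> exists l, L (e j) (e j.+1) = eseries (j + j.+1) l.
Proof.
by have [l lP] := filbr_e L => j0; exists (l j); rewrite lP // mul2n -addnn addn1 addnS.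
Qed.

Lemma br_eS i j : (0 < i)%N -> (0 < j)%N ->
  L (e i) (e j.+1) = L (e 0) (L (e i) (e j)) - L (e i.+1) (e j).
Proof. by move=> i0 j0; rewrite br_deriv !br_a // addrC addKr. Qed.

Definition abelian_from k :=
  forall i j, (k <= i)%N -> (k <= j)%N -> L (e i) (e j) = 0.

(** Two uses of [local_fil], one per argument, pass from basis vectors to infinite sums. *)
Lemma br_abelian k x y : abelian_from k -> fil k x -> fil k y -> L x y = 0.
Proof.
move=> ab kx ky; apply: fil_eqP => n.
apply: (local_fil (br_local x) _ ky) => j kj.
rewrite /= br_anti; apply: filN.
apply: (local_fil (br_local (e j)) _ kx) => i ki.
by rewrite /= ab // fil0.
Qed.

Hypothesis char0 : forall n, n.+1%:R != 0 :> K.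

(* With [l] and [v] the coefficients of [e_(h+1), e_(h+2)] and [e_h, e_(h+1)], the
   Jacobi identity for e_h, e_(h+1), e_(h+2) reads, the terms in [v] cancelling,
   sum_s (h + 1 + s) l_s l_(n-s) = 0 for all n. If l_p is the first nonzero
   coefficient, n = 2p gives (h + 1 + p) l_p ^ 2 = 0. *)
Lemma abelian_step h : (0 < h)%N -> abelian_from h.+2 -> abelian_from h.+1.
Proof.
move=> h0 ab; have [l lP] := br_ee (ltn0Sn h); have [v vP] := br_ee h0.
have lE n : L (e h.+1) (e (h.+2 + n)) = eseries (h.+1 + (h.+2 + n)) l.
  elim: n => [|n IH]; first by rewrite addn0 lP.
  rewrite addnS br_eS // IH ab ?subr0 ?br_a_eseries 1?addnS //.
  by rewrite ltnS leq_addr.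
(* By [br_eS], each increase of the second index shifts the series and subtracts
   [[e_(h+1), e_(h+2+n)]], that is, one more copy of [l]. *)
have vE n : L (e h) (e (h.+2 + n)) =
    eseries (h + (h.+2 + n)) (fun s => v s - n%:R * l s).
  elim: n => [|n IH].
    rewrite addn0 br_eS // vP br_self subr0 br_a_eseries -addnS.
    by congr eseries; apply/funext => s; rewrite mul0r subr0.
  have hS : (h.+1 + (h.+2 + n) = (h + (h.+2 + n)).+1)%N by [].
  rewrite addnS br_eS // IH lE br_a_eseries hS addnS.
  apply: formalP => k; rewrite !formalE /eseries.
  case: ifP => _; last by rewrite subrr.
  by rewrite -natr1 mulrDl mul1r opprD addrA.
have l0 p : (0 < p)%N -> l p = 0.
  elim/ltn_ind: p => p IH p0.
  have := br_deriv (e h) (e h.+1) (e h.+2).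
  (* The term [[[e_h, e_(h+1)], e_(h+2)]] vanishes, because [[e_h, e_(h+1)]] starts beyond
     [e_(h+1)]. *)
  rewrite [X in X + _](@br_abelian h.+2) // ?add0r; last 2 first.
  - by rewrite vP fil_eseries // -addnS leq_addl.
  - by rewrite fil_evec.
  rewrite -[in RHS](addn0 h.+2) vE -[in LHS](addn0 h.+2) lE !addn0.

  move/(congr1 (fun x : formal K => x ((h + (h.+1 + h.+2)) + p.*2)%N)).
  have p2 : (0 < p.*2)%N by rewrite double_gt0.
  rewrite (@local_eseries _ (L (e h)) _ (h + (h.+1 + h.+2))
    (fun s t => v t - (h.+1 + s)%:R * l t)) //; first last.
  - move=> s s0 /=.
    have -> : (h.+1 + h.+2 + s = h.+2 + (h.+1 + s))%N by lia.
    by rewrite vE; congr eseries; lia.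
  - exact: br_local.
  rewrite (@local_eseries _ (L (e h.+1)) _ (h + (h.+1 + h.+2))
    (fun s t => l t)) //; first last.
  - move=> s s0 /=.
    have -> : (h + h.+2 + s = h.+2 + (h + s))%N by lia.
    by rewrite lE; congr eseries; lia.
  - exact: br_local.
  (* The substitution of [2p - s] for [s] matches the terms in [v] on the two sides. *)
  have sum_rev : \sum_(1 <= s < p.*2) l s * v (p.*2 - s)%N =
      \sum_(1 <= s < p.*2) (v s - 0 * l s) * l (p.*2 - s)%N.
    rewrite [RHS]big_nat_rev; apply: eq_big_nat => s /andP[s0 sp].
    rewrite mul0r subr0 mulrC add1n subSS; congr (v _ * l _); lia.
  under eq_bigr do rewrite mulrBr; rewrite sumrB sum_rev => /eqP.
  rewrite -[eqbRHS]subr0 (inj_eq (addrI _)) eqr_opp.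
  rewrite (@big_cat_nat _ _ _ p) //=; last by lia.
  rewrite big_nat big1 ?add0r => [|s /andP[s0 sp]]; last by rewrite IH ?mul0r.
  rewrite big_ltn ?big_nat; last by lia.
  rewrite big1 ?addr0 => [|s /andP[ps sp]]; last first.
    by rewrite (IH (p.*2 - s)%N) ?mulr0 //; lia.
  have -> : (p.*2 - p = p)%N by lia.
  by rewrite !mulf_eq0 addSn (negPf (char0 _)) /= orbb => /eqP.
have ab1 j : (h.+2 <= j)%N -> L (e h.+1) (e j) = 0.
  move=> hj; rewrite -(subnKC hj) lE; apply: formalP => k; rewrite /eseries.
  by case: ifP => // kj; rewrite l0 // subn_gt0.
have eqh m : (h < m)%N -> (m < h.+2)%N -> m = h.+1.
  by rewrite ltnS => h1 h2; apply/eqP; rewrite eqn_leq h1 h2.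
move=> i j hi hj; have [hi2|ih] := leqP h.+2 i; have [hj2|jh] := leqP h.+2 j.
- exact: ab.
- by rewrite (eqh j) // br_anti ab1 ?oppr0.
- by rewrite (eqh i) // ab1.
- by rewrite (eqh i) // (eqh j) // br_self.
Qed.

Lemma abelian_from2 k : abelian_from k -> abelian_from 2.
Proof.
elim: k => [|[|[|h]] IH] ab; last by apply/IH/abelian_step.
all: by move=> i j i2 j2; apply: ab; lia.
Qed.

End Bracket.

(** * From solvability to an abelian tail *)

Section Solvable.
Context {K : fieldType}.
Variable L : infFiliform K.
Implicit Types (x y z : formal K) (i j k m n : nat).
Local Notation e := (@evec K).
Local Notation D := (derived_series L).

Lemma derived_series_subspace n : linear_subspace (D n).
Proof.
case: n => [|n] /=; first by split.
split=> [A [[A0 _] _] //|c x y Dx Dy A AP].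
by have [[_ Alin] _] := AP; apply: Alin; [exact: Dx|exact: Dy].
Qed.

Lemma derived_series_br n x y : D n x -> D n y -> D n.+1 (L x y).
Proof. by move=> Dx Dy A [_]; apply; exists x => //; exists y. Qed.

(** By minimality of the span it suffices to treat brackets, on which [L z] acts as a derivation, so
    that the induction applies to each factor. *)
Lemma derived_series_ideal n z x : D n x -> D n (L z x).
Proof.
elim: n x z => [//|n IH] x z; have [D0 Dlin] := derived_series_subspace n.+1.
apply: (@smallest_sub _ linear_subspace _ [set x | D n.+1 (L z x)]) => /=.
  split=> [/=|c u v /= Du Dv]; first by rewrite linear0r.
  by rewrite linearPr; exact: Dlin.
move=> _ [u Du [v Dv <-]] /=; rewrite br_deriv -[L (L z u) v]scale1r.
by apply: Dlin; apply: derived_series_br => //; exact: IH.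
Qed.

Lemma last_nonzero_derived : lie_solvable L ->
  exists m x, [/\ D m x, x != 0 & forall y, D m.+1 y -> y = 0].
Proof.
case; elim=> [|n IH] Dn.
  have : [set: formal K] (e 0) by [].
  rewrite -[setT]/(D 0) Dn => /(congr1 (fun x : formal K => x 0 : K))/eqP.
  by rewrite evecE oner_eq0.
have [/IH //|/eqP nDn] := pselect (D n = [set 0]).
suff [x Dx x0] : exists2 x, D n x & x != 0.
  by exists n, x; split=> // y; rewrite Dn.
apply: contrapT => H; case/eqP: nDn; apply/seteqP; split=> x /=.
  by move=> Dx; apply: contrapT => /eqP x0; apply: H; exists x.
by move=> ->; case: (derived_series_subspace n).
Qed.

(** The last nonzero term [D m] need not be closed, but its elements approximate every series of
    [fil k]; continuity then carries the vanishing of brackets over to the [e_i] with [k <= i]. *)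
Lemma solvable_abelian_from : lie_solvable L -> exists k, abelian_from L k.
Proof.
case/last_nonzero_derived => m [x [Dx x0 Dm0]].
have [D0 Dlin] := derived_series_subspace m.
(* If [[a, x]] is nonzero it has no component along [a]. Otherwise [x] is a multiple of [a], and
   [[e_1, x]] is a nonzero multiple of [e_2]. *)
have {x Dx x0} [x [Dx x0 xa]] : exists x, [/\ D m x, x != 0 & x 0 = 0 :> K].
  have [ax0|ax0] := eqVneq (L (e 0) x) 0; last first.
    by exists (L (e 0) x); split; rewrite ?br_aE //; exact: derived_series_ideal.
  have xE : x = x 0 *: e 0.
    apply: formalP => -[|k]; rewrite formalE evecE ?mulr1 ?mulr0 //.
    by have := congr1 (fun y : formal K => y k.+2 : K) ax0; rewrite br_aE.
  exists (L (e 1) x); split; first exact: derived_series_ideal.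
    apply: contraNneq x0; rewrite xE linearZr_LR br_anti br_a //.
    move/(congr1 (fun y : formal K => y 2 : K)); rewrite !formalE evecE mulrN1.
    move/eqP; rewrite oppr_eq0 => /eqP ->.
    by rewrite scale0r.
  by rewrite xE linearZr_LR br_anti br_a // !formalE evecE oppr0 mulr0.
have /ex_minnP[k xk kmin] : exists k, (x k : K) != 0.
  apply: contrapT => H; case/eqP: x0; apply: formalP => k; apply/eqP.
  by apply: contrapT => /negP xk; apply: H; exists k.
have k0 : (0 < k)%N by case: k xk {kmin} => //; rewrite xa eqxx.
(* Iterating [ad a] moves the leading index up one by one and keeps the leading coefficient; [k > 0]
   matters, as [ad a] kills coordinate 0. *)
have fx n : [/\ D m (iter n (L (e 0)) x), fil (k + n) (iter n (L (e 0)) x) &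
    iter n (L (e 0)) x (k + n)%N = x k :> K].
  elim: n => [|n [IH1 IH2 IH3]].
    split; rewrite ?addn0 //; apply/filP => i ik; apply/eqP/negPn/negP => /kmin.
    by rewrite leqNgt ik.
  have kn0 : (0 < k + n)%N by rewrite addn_gt0 k0.
  split; first exact: derived_series_ideal.
    by rewrite addnS -(prednK kn0); apply: fil_br_a; rewrite prednK.
  by rewrite iterS br_aE addnS ltnS kn0.
have approx y : fil k y -> forall n, exists2 y', D m y' & fil (k + n) (y' - y).
  move=> ky; elim=> [|n [y' Dy' yy']].
    by exists 0 => //; rewrite sub0r addn0; exact: filN.
  have [fD fk fkn] := fx n; pose c : K := (y - y') (k + n)%N / x k.
  exists (c *: iter n (L (e 0)) x + y'); first exact: Dlin.
  rewrite addnS -addrA; apply/filP => i; rewrite ltnS leq_eqVlt => /orP[/eqP->|ik].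
    by rewrite formalE formalZ fkn divfK // !formalE addrA subrK subrr.
  by apply: (fil_coord _ ik); apply: filD => //; exact: filZ.
exists k => i j ki kj; apply: formalP => q.
have [n nP] := br_near L (e i) (e j) q.
have [y' Dy' /(filW (leq_addl k n)) yi] := approx _ (fil_evec ki) n.
have [z' Dz' /(filW (leq_addl k n)) zj] := approx _ (fil_evec kj) n.
by rewrite -(nP _ _ yi zj) (Dm0 _ (derived_series_br Dy' Dz')).
Qed.

End Solvable.

(** * Algebras in which [e_2, e_3, ...] span an abelian ideal *)

Section Metabelian.
Context {K : fieldType}.
Variable L : infFiliform K.
Implicit Types (x y z : formal K) (i j k m n p : nat).
Local Notation e := (@evec K).

(** The coefficient of [T^(t+1)] in phi, since [T^(t+1)] sends [e_2] to [e_(3+t)]. *)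
Definition scoef t : K := L (e 1) (e 2) (3 + t)%N.

Lemma scoef0 : scoef 0 = 0.
Proof. by rewrite /scoef; have [l ->] := br_ee L (ltn0Sn 0); rewrite eseriesE. Qed.

Lemma iter_br_a n y k : fil 2 y ->
  iter n (L (e 0)) y k = if (n <= k)%N then y (k - n)%N else 0 :> K.
Proof.
move=> y2; elim: n k => [|n IH] k; first by rewrite subn0.
rewrite iterS br_aE IH; case: k => [|[|k]] //=.
by rewrite ltnS; case: n {IH} => // ; rewrite subn1 (fil_coord y2).
Qed.

Hypothesis ab : abelian_from L 2.

(** On the abelian ideal [e_1] commutes with [a], so its action is a shift of [[e_1, e_2]]. *)
Lemma br_e1 j : (2 <= j)%N -> L (e 1) (e j) = eseries j.+1 scoef.
Proof.
case: j => [|[|j]] // _; elim: j => [|j IH].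
  have [l lP] := br_ee L (ltn0Sn 0); rewrite /scoef lP.
  apply: formalP => k; rewrite /eseries; case: ltnP => // k3.
  by rewrite subnKC ?k3 // ltnW.
by rewrite br_eS // IH br_a_eseries ab // subr0.
Qed.

Lemma br_e1E p z m : (2 <= p)%N -> fil p z ->
  L (e 1) z (p.+1 + m)%N = \sum_(t < m.+1) scoef t * z (p + m - t)%N :> K.
Proof.
move=> p2 pz; rewrite (local_coord (br_local L (e 1)) (n := p + m.+1)); last first.
  move=> j pj /=; rewrite br_e1 ?(leq_trans p2) ?(leq_trans _ pj) ?leq_addr //.
  by rewrite /eseries ifF //; lia.
rewrite big_split_ord /= big1 ?add0r => [|i _]; last by rewrite (fil_coord pz) ?mul0r.
rewrite (reindex_inj rev_ord_inj) /=; apply: eq_bigr => i _.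
have im : (i <= m)%N by rewrite -ltnS.
rewrite subSS addnBA // br_e1; last by lia.
have -> : (p.+1 + m = (p + m - i).+1 + i)%N by lia.
(* [eseries] starts at index 1; the summand at index 0 agrees with it by [scoef0]. *)
by rewrite eseriesE; case: (posnP i) => [->|]; rewrite mulrC ?scoef0.
Qed.

Lemma fil_br_e1 n z : (2 <= n)%N -> fil n z -> fil n.+2 (L (e 1) z).
Proof.
move=> n2; apply: (local_fil (br_local L (e 1))) => j nj /=.
by rewrite br_e1 ?fil_eseries // (leq_trans n2).
Qed.

Lemma br_fil2 x z : fil 2 z -> L x z = x 0 *: L (e 0) z + x 1 *: L (e 1) z.
Proof.
move=> z2; rewrite -[x in LHS](subrK (trunc 2 x)) linearDl.
rewrite (br_abelian ab) ?fil_trunc // add0r /trunc big_ord_recl big_ord1.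
by rewrite linearDl !linearZl_LR.
Qed.

Lemma fil_br x n z : (2 <= n)%N -> fil n z -> fil n.+1 (L x z).
Proof.
move=> n2 nz; rewrite br_fil2; last exact: filW nz.
apply: filD; apply: filZ; last exact: filW (fil_br_e1 n2 nz).
by case: n n2 nz => // n _; exact: fil_br_a.
Qed.

Lemma fil2_br x y : fil 2 (L x y).
Proof.
rewrite -[y](subrK (trunc 2 y)) linearDr; apply: filD.
  by apply: (@filW _ 2 3) => //; apply: fil_br => //; exact: fil_trunc.
rewrite /trunc big_ord_recl big_ord1 linearDr !linearZr_LR; apply: filD; apply: filZ.
  by rewrite br_anti; apply: filN; exact: fil2_br_a.
rewrite br_anti; apply: filN.
apply: (local_fil (br_local L (e 1)) (m := 0)) => [[|[|j]] _ /=|]; last exact/filP.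
- by rewrite br_anti br_a //; apply: filN; exact: fil_evec.
- by rewrite br_self fil0.
- by rewrite br_e1 ?fil_eseries.
Qed.

End Metabelian.

(** * Effect of a homomorphism on the coefficients of phi *)

Section Homomorphism.
Context {K : fieldType}.
Variables (M N : infFiliform K) (f : {linear formal K -> formal K}).
Implicit Types (x y z : formal K) (i j k m n r t : nat).
Local Notation e := (@evec K).
Local Notation c := (scoef M).
Local Notation d := (scoef N).

Hypotheses (abM : abelian_from M 2) (abN : abelian_from N 2).
Hypothesis f_br : forall x y, f (M x y) = N (f x) (f y).

(** [f] is not assumed continuous. The filtration is nevertheless respected, because it is
    algebraic: every element of [fil n.+1], for [n >= 1], is [[a, y]] with [y] in [fil n]. *)
Lemma hom_fil n x : (2 <= n)%N -> fil n x -> fil n (f x).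
Proof.
have shiftP z : fil 2 z ->
    exists2 y, z = M (e 0) y & forall m, fil m.+1 z -> fil m y.
  move=> z2; exists (fun k => if k is 0 then 0 else z k.+1) => [|m mz].
    apply: formalP => -[|[|k]]; rewrite br_aE //=; exact: fil_coord z2 _.
  by apply/filP => -[|k] km //; exact: fil_coord mz _.
case: n => [|[|n]] // _; elim: n x => [|n IH] x nx.
  by have [y -> _] := shiftP x nx; rewrite f_br; exact: fil2_br.
have [y xE /(_ _ nx) yn] := shiftP x (filW (isT : 2 <= n.+3)%N nx).
by rewrite xE f_br; apply: fil_br => //; exact: IH.
Qed.

(** With [fil 2] read as power series in T and [e_2] as 1, this is [(al T + be psi(T))^n]. *)
Definition e2_orbit n : formal K := iter n (N (f (e 0))) (e 2).
Arguments e2_orbit : simpl never.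

Section Relation.
Variable y0 : formal K.
Hypotheses (y02 : fil 2 y0) (fy0 : f y0 = e 2).

(** [e_1] raises the filtration by two but [a] only by one, so a component of [f (e 1)] along [a]
    would show in coordinate 3. *)
Lemma hom_e1_coord0 : f (e 1) 0 = 0 :> K.
Proof.
have /fil_coord/(_ (ltnSn 3)) : fil 4 (N (f (e 1)) (e 2)).
  by rewrite -fy0 -f_br; apply: hom_fil => //; exact: fil_br_e1.
rewrite br_fil2 ?fil_evec // br_a // !formalE evecE eqxx mulr1.
by rewrite (fil_coord (fil_br_e1 abN _ (fil_evec (leqnn 2)))) // mulr0 addr0.
Qed.

Let al : K := f (e 0) 0.
Let be : K := f (e 0) 1.
Let ga : K := f (e 1) 1.
Local Notation Y := e2_orbit.

(* The coefficientwise form of ga psi(T) = phi(al T + be psi(T)), where T is the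
   action of [a] on [fil 2] and [phi], [psi] are the power series in T by which
   [e_1] acts there in [M] and in [N]. *)
Lemma hom_relation m :
  ga * d m = \sum_(0 <= t < m.+1) c t * Y t.+1 (3 + m)%N :> K.
Proof.
rewrite big_mkord.
have fiter n : f (iter n (M (e 0)) y0) = Y n.
  by rewrite /e2_orbit -fy0; elim: n => //= n <-; exact: f_br.
pose S := \sum_(t < m.+1) c t *: iter t.+1 (M (e 0)) y0.
have fS : f S (3 + m)%N = \sum_(t < m.+1) c t * Y t.+1 (3 + m)%N :> K.
  rewrite /S linear_sum formalE; apply: eq_bigr => t _; rewrite linearZ /= formalE.
  by rewrite -fiter f_br.
(* [S] is a finite part of [phi(T) y0]. By [hom_fil] the image of the remainder is invisible in
   coordinate [3 + m], which takes the place of continuity of [f]. *)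
have rest : fil (4 + m) (M (e 1) y0 - S).
  apply/filP => k; have [k3 _|k3 km] := ltnP k 3.
    rewrite formalE formalN (fil_coord (fil_br_e1 abM _ y02)) ?(leq_trans k3) // sub0r.
    rewrite /S formalE big1 ?oppr0 // => t _; rewrite formalE iter_br_a //.
    case: ifP; rewrite ?mulr0 // => tk; rewrite (fil_coord y02) ?mulr0 //; lia.
  rewrite -(subnKC k3) formalE formalN; apply/eqP; rewrite subr_eq0; apply/eqP.
  rewrite br_e1E // /S formalE.
  rewrite (big_ord_widen m.+1 (fun t => c t * y0 (2 + (k - 3) - t)%N)); last by lia.
  rewrite big_mkcond; apply: eq_bigr => t _; rewrite formalE iter_br_a //.
  case: ifP => tk; first by rewrite ifT; [congr (_ * y0 _ : K)|]; lia.
  case: ifP => tk'; rewrite ?mulr0 // (fil_coord y02) ?mulr0 //; lia.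
rewrite -fS -[RHS]add0r -(fil_coord (hom_fil _ rest) (ltnSn (3 + m)%N)) //.
rewrite linearB formalE formalN addrNK f_br fy0 br_fil2 ?fil_evec //.
rewrite hom_e1_coord0 scale0r add0r.
by rewrite formalE.
Qed.

Lemma fil_Y n : fil n.+2 (Y n).
Proof. by elim: n => [|n IH]; [exact: fil_evec|apply: fil_br]. Qed.

Lemma YS n i : Y n.+1 (n.+3 + i)%N =
  al * Y n (n.+2 + i)%N + be * (\sum_(t < i.+1) d t * Y n (n.+2 + i - t)%N) :> K.
Proof.
rewrite /e2_orbit iterS -/(Y n) br_fil2 //; last exact: filW (fil_Y n).
by rewrite !formalE br_aE (br_e1E abN _ _ (fil_Y n)).
Qed.

Section LowOrder.
Variable r : nat.
Hypotheses (al0 : al != 0) (r0 : (0 < r)%N) (d0 : forall t, (t < r)%N -> d t = 0).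

(** As psi starts in degree at least [r + 1], [(al T + be psi)^n] agrees with [al^n T^n] below
    degree [n + r]. *)
Lemma Y_low n i : (i < r)%N -> Y n (n.+2 + i)%N = if i == 0 then al ^+ n else 0 :> K.
Proof.
elim: n => [|n IH] ir; first by case: i ir.
rewrite YS big1 => [|t _]; last by rewrite d0 ?mul0r //; apply: leq_trans ir.
by rewrite IH // mulr0 addr0; case: eqP; rewrite ?mulr0 // exprS.
Qed.

Lemma Y_lead n : Y n n.+2 = al ^+ n :> K.
Proof. by rewrite -[n.+2]addn0 Y_low. Qed.

(** The term of first order in psi of the binomial expansion; at [n = 0] the factor [n%:R] makes the
    exponent [n.-1] harmless. *)
Lemma Y_r n : Y n (n.+2 + r)%N = n%:R * al ^+ n.-1 * be * d r :> K.
Proof.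
elim: n => [|n IH]; first by rewrite /e2_orbit /= evecE !mul0r gtn_eqF //; lia.
rewrite YS big_ord_recr /= big1 ?add0r => [|t _]; last by rewrite d0 ?mul0r.
rewrite IH addnK Y_lead.
by case: n {IH} => [|n] /=; rewrite ?exprS; ring.
Qed.

(** Only the summand [t = m] survives: for [t < r] the coefficient [c t] is zero by induction, and
    for [r <= t < m] the orbit vanishes there by [Y_low]. *)
Lemma hom_low m : (m < r + r)%N -> ga * d m = c m * al ^+ m.+1.
Proof.
elim/ltn_ind: m => m IH mr.
rewrite hom_relation big_nat_recr //= big_nat big1 => [|t /andP[_ tm]].
  by rewrite add0r (Y_lead m.+1).
have tmE : (3 + m = t.+3 + (m - t))%N by lia.
have [tr|rt] := ltnP t r; last first.
  by rewrite tmE Y_low ?subn_eq0 1?leqNgt ?tm ?mulr0 //; lia.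
have /esym/eqP := IH t tm (leq_trans tr (leq_addr _ _)).
rewrite d0 // mulr0 mulf_eq0 expf_eq0 (negPf al0) andbF orbF => /eqP ->.
by rewrite mul0r.
Qed.

Lemma hom_low_coef t : (t < r)%N -> c t = 0.
Proof.
move=> tr; have /esym/eqP := hom_low (leq_trans tr (leq_addr _ _)).
by rewrite d0 // mulr0 mulf_eq0 expf_eq0 (negPf al0) andbF orbF => /eqP.
Qed.

(** At index [2r] one more summand survives, [t = r], and [Y_r] evaluates it; this is where [be]
    first enters. *)
Lemma hom_double :
  ga * d (r + r)%N = c (r + r)%N * al ^+ (r + r).+1 +
    r.+1%:R * c r * al ^+ r * be * d r.
Proof.
rewrite hom_relation big_nat_recr //= (Y_lead (r + r).+1) addrC.
congr (_ + _); have rlt : (r < r + r)%N by lia.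
rewrite big_mkord (bigD1 (Ordinal rlt)) //= big1 ?addr0 => [|t tr].
  by rewrite (Y_r r.+1) /=; ring.
have [tr'|rt] := ltnP t r; first by rewrite hom_low_coef ?mul0r.
have trn : (t : nat) != r by apply: contraNneq tr => tr; apply/eqP/val_inj.
have -> : (3 + (r + r) = t.+3 + (r + r - t))%N by have := ltn_ord t; lia.
rewrite Y_low; last by lia.
by rewrite subn_eq0 leqNgt ltn_ord mulr0.
Qed.

End LowOrder.

Lemma Y_diag n : be = 0 -> Y n = al ^+ n *: e n.+2.
Proof.
move=> be0; elim: n => [|n IH]; first by rewrite expr0 scale1r.
rewrite /e2_orbit iterS -/(Y n) br_fil2 //; last exact: filW (fil_Y n).
by rewrite -/be be0 scale0r addr0 IH linearZr_LR br_a // scalerA -exprS.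
Qed.

Lemma hom_diag m : be = 0 -> ga * d m = c m * al ^+ m.+1.
Proof.
move=> be0; rewrite hom_relation big_nat_recr //= big_nat big1 => [|t /andP[_ tm]].
  by rewrite add0r Y_diag // formalE evecE eqxx mulr1.
by rewrite Y_diag // formalE evecE gtn_eqF ?mulr0 // !ltnS.
Qed.
End Relation.
End Homomorphism.

(** * Infinite triangular matrices *)

Section Triangular.
Context {K : fieldType}.
Implicit Types (x y z : formal K) (i j k m n : nat).
Local Notation e := (@evec K).
Variable b : nat -> formal K.
Hypotheses (fil_b : forall i, fil i (b i)) (b_diag : forall i, (b i i : K) != 0).

(** The infinite sum of the [x i *: b i]; since [b i] lies in [fil i], only [i <= k] contributes to
    coordinate [k]. *)
Definition triangular x : formal K := fun k => \sum_(i < k.+1) x i * b i k.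

Lemma triangular_is_linear : linear triangular.
Proof.
move=> c x y; apply: formalP => k.
rewrite formalD formalZ /triangular mulr_sumr -big_split /=.
by apply: eq_bigr => i _; rewrite mulrDl mulrA.
Qed.

HB.instance Definition _ :=
  GRing.isLinear.Build K (formal K) (formal K) _ triangular triangular_is_linear.

(** The converse is forward substitution along the nonzero diagonal. The equivalence gives
    injectivity and makes the inverse respect the filtration. *)
Lemma fil_triangular n x : fil n x = fil n (triangular x).
Proof.
apply/idP/idP => xn; apply/filP => k kn.
  rewrite /triangular big1 // => i _.
  by rewrite (fil_coord xn) ?mul0r // (leq_ltn_trans _ kn) // -ltnS.
elim/ltn_ind: k kn => k IH kn; have := fil_coord xn kn.
rewrite /triangular big_ord_recr /= big1 ?add0r => [/eqP|i _].
  by rewrite mulf_eq0 (negPf (b_diag k)) orbF => /eqP.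
by rewrite IH ?mul0r // (ltn_trans (ltn_ord i)).
Qed.

Lemma triangular_evec i : triangular (e i) = b i.
Proof.
apply: formalP => k; rewrite /triangular; have [ik|ki] := leqP i k.
  rewrite (bigD1 (Ordinal (n := k.+1) ik)) //= evecE eqxx mul1r big1 ?addr0 // => j ji.
  by rewrite evecE; case: eqP => [ij|]; rewrite ?mul0r //; case/eqP: ji; apply: val_inj.
rewrite (fil_coord (fil_b i)) // big1 // => j _.
by rewrite evecE ltn_eqF ?mul0r // (leq_trans (ltn_ord j)).
Qed.

Lemma triangular_inj : injective triangular.
Proof.
move=> x y xy; apply/eqP; rewrite -subr_eq0; apply/eqP/fil_eqP => n.
by rewrite fil_triangular linearB /= xy subrr fil0.
Qed.

Lemma triangular_surj y : exists x, triangular x = y.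
Proof.
pose step n x := x + ((y - triangular x) n / b n n) *: e n.
pose u := fix u n := if n is m.+1 then step m (u m) else 0.
have uP n : fil n (y - triangular (u n)).
  elim: n => [|n IH]; first exact/filP.
  rewrite /= /step linearD linearZ_LR /= triangular_evec opprD addrA.
  apply/filP => k; rewrite ltnS leq_eqVlt => /orP[/eqP->|kn].
    by rewrite !formalE divfK // subrr.
  by apply: (fil_coord _ kn); apply: filB => //; exact: filZ.
have uS n m : fil n (u (n + m)%N - u n).
  rewrite fil_triangular linearB /= -(subrKA y) -opprB addrC.
  by apply: filB (uP n) _; apply: filW (uP _); exact: leq_addr.
(* Stage [n] corrects only coordinate [n], so coordinate [k] is final from stage [k + 1] on and the
   limit is read off diagonally. *)
exists (fun k => u k.+1 k); apply/eqP; rewrite eq_sym -subr_eq0; apply/eqP/fil_eqP => n.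
have nu : fil n ((fun k => u k.+1 k : K) - u n : formal K).
  apply/filP => k kn; rewrite formalE formalN; apply/eqP; rewrite subr_eq0; apply/eqP.
  have := fil_coord (uS k.+1 (n - k.+1)%N) (ltnSn k); rewrite subnKC // formalE formalN.
  by move/eqP; rewrite subr_eq0 => /eqP.
move: nu; rewrite fil_triangular linearB /= => /filN; rewrite opprB => nu.
by have := filD (uP n) nu; rewrite subrKA.
Qed.

Lemma triangular_bij : bijective triangular.
Proof.
have /choice[g gK] := triangular_surj.
by exists g => // x; apply: triangular_inj.
Qed.

Lemma triangular_map : exists f : {linear formal K -> formal K},
  [/\ forall i, f (e i) = b i, forall n x, fil n x = fil n (f x) & bijective f].
Proof.
exists [the {linear formal K -> formal K} of triangular].
by split; [exact: triangular_evec|exact: fil_triangular|exact: triangular_bij].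
Qed.

End Triangular.

(** * Pulling a filiform bracket back along a linear bijection *)

Section Transport.
Context {K : fieldType}.

Lemma fil_eseriesP n (x : formal K) :
  fil n.+1 x -> x = eseries n (fun s => x (n + s)%N).
Proof.
move=> xn; apply: formalP => k; rewrite /eseries; case: ltnP => nk.
  by rewrite subnKC // ltnW.
exact: fil_coord xn _.
Qed.

Lemma inv_linear (f : {linear formal K -> formal K}) : bijective f ->
  exists g : {linear formal K -> formal K}, cancel f g /\ cancel g f.
Proof.
case=> g fK gK; have glin : linear g := can2_linear fK gK.
pose gl := GRing.isLinear.Build K (formal K) (formal K) _ g glin.
by pose G : {linear formal K -> formal K} := HB.pack g gl; exists G.
Qed.

(** The last two hypotheses are the filiform equations for the pulled-back bracket; locality of both
    maps gives its continuity. *)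
Lemma infFiliform_transport (L : infFiliform K) (f g : {linear formal K -> formal K}) :
    cancel f g -> cancel g f -> local_map f -> local_map g ->
    (forall j, (0 < j)%N -> L (f (evec 0)) (f (evec j)) = f (evec j.+1)) ->
    (forall j, (0 < j)%N -> fil (j + j.+1).+1 (g (L (f (evec j)) (f (evec j.+1))))) ->
  exists M : infFiliform K, forall x y, f (M x y) = L (f x) (f y).
Proof.
move=> fK gK f_loc g_loc fa fe; pose br x y := g (L (f x) (f y)).
have brl : bilinear_for *:%R *:%R br.
  by split=> u c v w; rewrite /br !linearP // linearPl linearP.
pose bb := bilinear_isBilinear.Build K (formal K) (formal K) (formal K)
  *:%R *:%R br brl.
pose B : {bilinear formal K -> formal K -> formal K} := HB.pack br bb.
have Balt : alternating B by move=> x; rewrite /= /br br_self linear0.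
have Bjac : jacobi B.
  by move=> x y z; rewrite /= /br !gK -!linearD filbr_jacobi linear0.
have Bcont : continuous (fun p : formal K * formal K => B p.1 p.2).
  case=> x y; have cfx : f p.1 @[p --> (x, y)] --> f x.
    apply: (@cvg_comp _ _ _ fst f (nbhs (x, y)) (nbhs x)); first exact: cvg_fst.
    exact: local_continuous.
  have cfy : f p.2 @[p --> (x, y)] --> f y.
    apply: (@cvg_comp _ _ _ snd f (nbhs (x, y)) (nbhs y)); first exact: cvg_snd.
    exact: local_continuous.
  have cL := cvg_comp _ _ (cvg_pair cfx cfy) (@filbr_continuous K L (f x, f y)).
  apply: (@cvg_comp _ _ _ (fun p => L (f p.1) (f p.2)) g _ (nbhs (L (f x) (f y)))).
    exact: cL.
  have gc := local_continuous g_loc (x := L (f x) (f y)).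
  exact gc.
have Ba j : (1 <= j)%N -> B avec (evec j) = evec j.+1.
  by move=> j0; rewrite /= /br fa // fK.
have Be : exists lam : nat -> nat -> K, forall j, (1 <= j)%N ->
    B (evec j) (evec j.+1) = eseries (2 * j + 1) (lam j).
  exists (fun j s => B (evec j) (evec j.+1) (j + j.+1 + s)%N) => j j0.
  have -> : (2 * j + 1 = j + j.+1)%N by lia.
  exact: fil_eseriesP (fe j j0).
by exists (InfFiliform Balt Bjac Bcont Ba Be) => x y; rewrite /= /br gK.
Qed.

End Transport.

(** * Isomorphisms and their parameters *)

Section Isomorphism.
Context {K : fieldType}.
Implicit Types (L M N : infFiliform K).
Local Notation e := (@evec K).

Lemma lie_isomorphic_refl L : lie_isomorphic L L.
Proof.
exists [the {linear formal K -> formal K} of idfun].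
by split; [exists idfun|].
Qed.

Lemma lie_isomorphic_sym L M : lie_isomorphic L M -> lie_isomorphic M L.
Proof.
case=> f [fbij fM]; have [g [fK gK]] := inv_linear fbij; exists g; split.
  by exists f.
by move=> x y; apply: (can_inj fK); rewrite fM !gK.
Qed.

Lemma lie_isomorphic_trans L M N :
  lie_isomorphic L M -> lie_isomorphic M N -> lie_isomorphic L N.
Proof.
case=> f [fbij fM] [g [gbij gN]].
exists [the {linear formal K -> formal K} of g \o f]; split=> [|x y /=].
  exact: bij_comp.
by rewrite fM gN.
Qed.

(* The induced maps on the quotients by [fil 2], spanned by [a] and [e_1], are
   mutually inverse and lower triangular. *)
Lemma iso_relation M N : abelian_from M 2 -> abelian_from N 2 ->
    lie_isomorphic M N ->
  exists f : {linear formal K -> formal K}, [/\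
    forall x y, f (M x y) = N (f x) (f y),
    exists2 y0, fil 2 y0 & f y0 = e 2,
    (f (e 0) 0 : K) != 0 & (f (e 1) 1 : K) != 0].
Proof.
move=> abM abN [f [fbij f_br]]; have [g [fK gK]] := inv_linear fbij.
have g_br x y : g (N x y) = M (g x) (g y) by apply: (can_inj fK); rewrite f_br !gK.
have f2 := hom_fil abN f_br (leqnn 2).
have g2 := hom_fil abM g_br (leqnn 2).
have f10 : f (e 1) 0 = 0 :> K.
  exact: (hom_e1_coord0 abM abN f_br (g2 _ (fil_evec (leqnn 2))) (gK _)).
have g10 : g (e 1) 0 = 0 :> K.
  exact: (hom_e1_coord0 abN abM g_br (f2 _ (fil_evec (leqnn 2))) (fK _)).
have gE x k : (k < 2)%N -> g x k = x 0 * g (e 0) k + x 1 * g (e 1) k :> K.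
  move=> k2; rewrite -[x in LHS](subrK (trunc 2 x)) linearD formalE.
  rewrite (fil_coord (g2 _ (fil_trunc 2 x)) k2) add0r /trunc big_ord_recl big_ord1.
  by rewrite linearD !linearZ_LR !formalE.
exists f; split=> //.
- by exists (g (e 2)); [apply/g2/fil_evec|rewrite gK].
- have := gE (f (e 0)) 0 isT; rewrite fK g10 mulr0 addr0 evecE.
  by apply: contra_eq_neq => ->; rewrite mul0r oner_eq0.
- have := gE (f (e 1)) 1 isT; rewrite fK f10 mul0r add0r evecE.
  by apply: contra_eq_neq => ->; rewrite mul0r oner_eq0.
Qed.

End Isomorphism.

(** * Realizing prescribed parameters *)

Section ChangeOfBasis.
Context {K : fieldType}.
Local Notation e := (@evec K).

(** The map [f] goes from the new algebra to [L], so in the coefficient relations [c] belongs to [M]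
    and [d] to [L]. *)
Lemma change_basis (L : infFiliform K) (al be ga : K) :
    abelian_from L 2 -> al != 0 -> ga != 0 ->
  exists M (f : {linear formal K -> formal K}), [/\ abelian_from M 2,
    lie_isomorphic L M,
    forall x y, f (M x y) = L (f x) (f y),
    exists2 y0, fil 2 y0 & f y0 = e 2 &
    f (e 0) = al *: e 0 + be *: e 1 /\ f (e 1) = ga *: e 1].
Proof.
move=> abL al0 ga0; pose b0 := al *: e 0 + be *: e 1.
have b00 : b0 0 = al :> K by rewrite /b0 !formalE !evecE mulr1 mulr0 addr0.
(* The equations [[a, e_j] = e_(j+1)] force these images, starting with [[b0, ga e_1] = al ga
   e_2]. *)
pose b2 n := iter n (L b0) ((al * ga) *: e 2).
pose b i := match i with 0 => b0 | 1 => ga *: e 1 | n.+2 => b2 n end.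
have fil_b2 n : fil n.+2 (b2 n).
  by elim: n => [|n IH]; [exact/filZ/fil_evec|exact: fil_br].
have b2_diag n : b2 n n.+2 = al * ga * al ^+ n :> K.
  elim: n => [|n IH]; first by rewrite /b2 /= formalE evecE eqxx mulr1.
  rewrite /b2 iterS -/(b2 n) br_fil2 //; last exact: filW (fil_b2 n).
  rewrite formalE !formalZ br_aE IH (fil_coord (fil_br_e1 abL _ (fil_b2 n))) //.
  by rewrite mulr0 addr0 b00 exprS mulrCA.
have fil_b i : fil i (b i).
  by case: i => [|[|n]]; [exact/filP|exact/filZ/fil_evec|exact: fil_b2].
have b_diag i : (b i i : K) != 0.
  case: i => [|[|n]] /=; first by rewrite b00.
    by rewrite formalE evecE eqxx mulr1.
  by rewrite b2_diag !mulf_neq0 // expf_neq0.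
have [f [fe f_fil fbij]] := triangular_map fil_b b_diag.
have [g [fK gK]] := inv_linear fbij.
have g_fil n x : fil n x -> fil n (g x) by rewrite (f_fil n (g x)) gK.
have loc (h : {linear formal K -> formal K}) :
    (forall n x, fil n x -> fil n (h x)) -> local_map h.
  by move=> hf k; exists k.+1 => x xk; exact: fil_coord (hf _ _ xk) (ltnSn k).
have fa j : (0 < j)%N -> L (f (e 0)) (f (e j)) = f (e j.+1).
  rewrite !fe; case: j => [|[|n]] //= _.
  rewrite linearZr_LR linearDl !linearZl_LR br_a // br_self scaler0 addr0.
  by rewrite scalerA mulrC.
have fbb i j : (2 <= i)%N -> (2 <= j)%N -> L (f (e i)) (f (e j)) = 0.
  by move=> i2 j2; apply: (br_abelian abL); rewrite -f_fil; exact: fil_evec.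
have fee j : (0 < j)%N -> fil (j + j.+1).+1 (g (L (f (e j)) (f (e j.+1)))).
  case: j => [//|[|j]] _; last by rewrite fbb // linear0 fil0.
  apply: g_fil; rewrite !fe /= linearZl_LR linearZr_LR.
  by apply/filZ/filZ; exact: (fil_br_e1 abL (leqnn 2) (fil_evec (leqnn 2))).
have f_loc : local_map f by apply: loc => n x; rewrite f_fil.
have [M MP] := infFiliform_transport fK gK f_loc (loc g g_fil) fa fee.
exists M, f; split=> //.
- by move=> i j i2 j2; apply: (can_inj fK); rewrite MP fbb // linear0.
- exists g; split; first by exists f.
  by move=> x y; apply: (can_inj fK); rewrite MP !gK.
- exists ((al * ga)^-1 *: e 2); first exact/filZ/fil_evec.
  by rewrite linearZ_LR fe /b /b2 /= scalerA mulVf ?mulf_neq0 // scale1r.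
Qed.

End ChangeOfBasis.

(** * Uniqueness and existence of the normal form *)

Section NormalForm.
Context {K : fieldType}.
Implicit Types (L M N : infFiliform K) (c : nat -> K) (r s : nat).
Local Notation e := (@evec K).

Definition normal_coefs c r s :=
  [/\ c r = 1, c s = 1, c (2 * r)%N = 0 &
      forall t, (t < s)%N -> t != r -> c t = 0].

Lemma normal_form_coefs M r s lam :
    (0 < r)%N -> (r < s)%N -> s != (2 * r)%N -> normal_form M r s lam ->
  abelian_from M 2 /\ normal_coefs (scoef M) r s.
Proof.
move=> r0 rs sr [_ M1 M2]; split; first exact: M2.
have cE t : (0 < t)%N -> scoef M t = (t == r)%:R + (t == s)%:R +
    (if (s < t)%N && (t != 2 * r)%N then lam t else 0).
  by move=> t0; rewrite /scoef M1 // !formalE !evecE !eqn_add2l eseriesE t0.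
split.
- by rewrite cE // eqxx (ltn_eqF rs) ltnNge ltnW // !addr0.
- by rewrite cE ?(ltn_trans r0) // eqxx (gtn_eqF rs) ltnn add0r addr0.
- rewrite cE ?muln_gt0 // eqxx andbF addr0 [_ == s]eq_sym (negPf sr).
  by rewrite gtn_eqF ?addr0 //; lia.
- move=> t ts tr; case: (posnP t) => [->|t0]; first exact: scoef0.
  by rewrite cE // (negPf tr) (ltn_eqF ts) ltnNge ltnW // !addr0.
Qed.

Lemma coefs_normal_form M r s :
    (0 < r)%N -> (r < s)%N -> abelian_from M 2 -> normal_coefs (scoef M) r s ->
  normal_form M r s (scoef M).
Proof.
move=> r0 rs abM [cr cs c2r c0]; split=> [i i1|i i2|]; [exact: br_a| |exact: abM].
rewrite br_e1 // add1n; apply: formalP => k; rewrite !formalE !evecE.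
have [ki|ik] := leqP k i.+1.
  rewrite /eseries ltnNge ki !ltn_eqF ?addr0 //; lia.
rewrite -(subnKC (ltnW ik)); set t := (k - i.+1)%N.
have t0 : (0 < t)%N by rewrite subn_gt0.
rewrite !eseriesE !eqn_add2l t0; have [->|tr] := eqVneq t r.
  by rewrite (ltn_eqF rs) ltnNge ltnW //= !addr0.
have [->|ts] := eqVneq t s; first by rewrite ltnn /= add0r addr0.
rewrite add0r add0r; case: (ltngtP s t) ts => // [st|ts] _ /=; last exact: c0.
by case: eqVneq => [->|].
Qed.

Lemma scoef_monomial M r : (0 < r)%N -> abelian_from M 2 ->
  (forall t, t != r -> scoef M t = 0) -> monomial_form M r (scoef M r).
Proof.
move=> r0 abM c0; split=> [i i1|i i2|]; [exact: br_a| |exact: abM].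
rewrite br_e1 // add1n; apply: formalP => k; rewrite formalE evecE.
have [ki|ik] := leqP k i.+1.
  rewrite /eseries ltnNge ki ltn_eqF ?mulr0 //; lia.
rewrite -(subnKC (ltnW ik)) eseriesE eqn_add2l subn_gt0 ik.
by case: eqVneq => [->|/c0 ->]; rewrite ?mulr1 ?mulr0.
Qed.

Hypothesis char0 : forall n, n.+1%:R != 0 :> K.

Lemma normal_coefs_unique M N r s r' s' :
    abelian_from M 2 -> abelian_from N 2 -> lie_isomorphic M N ->
    (0 < r)%N -> (r < s)%N -> normal_coefs (scoef M) r s ->
    (0 < r')%N -> (r' < s')%N -> normal_coefs (scoef N) r' s' ->
  (r, s) = (r', s').
Proof.
move=> abM abN MN r0 rs [cr cs c2r c0] r0' rs' [dr ds d2r d0].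
have [f [f_br [y0 y02 fy0] al0 ga0]] := iso_relation abM abN MN.
have d_lt t : (t < r')%N -> scoef N t = 0.
  by move=> tr; rewrite d0 ?(ltn_trans tr) // ltn_eqF.
have eq0 m : f (e 1) 1 * scoef N m = scoef M m * f (e 0) 0 ^+ m.+1 ->
    (scoef N m == 0) = (scoef M m == 0).
  move=> /(congr1 (eq_op^~ 0)); rewrite !mulf_eq0 expf_eq0.
  by rewrite (negPf al0) (negPf ga0) andbF orbF.
have low m : (m < r' + r')%N -> (scoef N m == 0) = (scoef M m == 0).
  by move=> mr; apply: eq0; exact: (hom_low abM abN f_br y02 fy0 al0 r0' d_lt mr).
have rr : r = r'.
  case: (ltngtP r r') => // [rr|rr].
    have := low r (leq_trans rr (leq_addr _ _)).
    by rewrite cr d_lt // eqxx oner_eq0.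
  have rlt' : (r' < r' + r')%N by lia.
  by have := low r' rlt'; rewrite dr c0 ?(ltn_trans rr) ?(ltn_eqF rr) // eqxx oner_eq0.
(* Both coefficients of index [2r] vanish, so [hom_double] reduces to [(r + 1) al^r be = 0]. *)
have be0 : f (e 0) 1 = 0 :> K.
  have /esym/eqP := hom_double abM abN f_br y02 fy0 al0 r0' d_lt.
  rewrite addnn -mul2n d2r dr -rr c2r cr mulr0 mul0r add0r !mulr1.
  by rewrite !mulf_eq0 expf_eq0 (negPf al0) (negPf (char0 _)) andbF /= => /eqP.
have alleq m : (scoef N m == 0) = (scoef M m == 0).
  by apply: eq0; exact: (hom_diag abM abN f_br y02 fy0).
congr pair => //; case: (ltngtP s s') => // [ss|ss].
  by have := alleq s; rewrite cs d0 -?rr ?(gtn_eqF rs) // eqxx oner_eq0.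
by have := alleq s'; rewrite ds c0 ?rr ?(gtn_eqF rs') // eqxx oner_eq0.
Qed.

Hypothesis has_root : forall n (x : K), (0 < n)%N -> exists y, y ^+ n = x.

Lemma normal_coefs_exist L : abelian_from L 2 -> ~ monomial_type L ->
  exists r s M, [/\ (0 < r)%N, (r < s)%N, s != (2 * r)%N &
    [/\ abelian_from M 2, normal_coefs (scoef M) r s & lie_isomorphic L M]].
Proof.
move=> abL nonmono.
have first_nz c (P : pred nat) : ~ (forall t, P t -> c t = 0) ->
    exists2 r, P r && (c r != 0) & forall t, (t < r)%N -> P t -> c t = 0.
  move=> cP; have /ex_minnP[r rP rmin] : exists r, P r && (c r != 0).
    apply: contrapT => nP; apply: cP => t Pt; apply/eqP/negPn/negP => ct.
    by apply: nP; exists t; rewrite Pt.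
  exists r => // t tr Pt; apply/eqP/negPn/negP => ct.
  by have := rmin t; rewrite Pt ct leqNgt tr => /(_ isT).
have [|r /= dr d_lt] := first_nz (scoef L) predT.
  (* Here phi is zero, so [L] is monomial with constant 0 for any exponent; 1 is chosen. *)
  move=> d0; apply: nonmono; exists 1%N, (scoef L 1), L; split=> //.
    by apply: scoef_monomial => // t _; exact: d0.
  exact: lie_isomorphic_refl.
have r0 : (0 < r)%N by case: r dr {d_lt} => //; rewrite scoef0 eqxx.
have {}d_lt t : (t < r)%N -> scoef L t = 0 by move=> tr; exact: d_lt.
(* The solution of [hom_double] with [al = ga = 1] and new coefficient 0 at [2r]; the coefficients
   below [2r] do not change. *)
pose be : K := scoef L (r + r)%N / (r.+1%:R * scoef L r * scoef L r).
have [M [f [abM LM f_br [y0 y02 fy0] [f0 f1]]]] :=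
  change_basis be abL (oner_neq0 K) (oner_neq0 K).
have f00 : f (e 0) 0 = 1 :> K by rewrite f0 !formalE !evecE mulr1 mulr0 addr0.
have f01 : f (e 0) 1 = be :> K by rewrite f0 !formalE !evecE mulr1 mulr0 add0r.
have f11 : f (e 1) 1 = 1 :> K by rewrite f1 !formalE !evecE mulr1.
have al0 : (f (e 0) 0 : K) != 0 by rewrite f00 oner_neq0.
have low m : (m < r + r)%N -> scoef M m = scoef L m.
  move=> mr; have := hom_low abM abL f_br y02 fy0 al0 r0 d_lt mr.
  by rewrite f00 f11 expr1n mul1r mulr1.
have rlt : (r < r + r)%N by lia.
have c2r : scoef M (2 * r)%N = 0.
  have := hom_double abM abL f_br y02 fy0 al0 r0 d_lt.
  rewrite f00 f01 f11 !expr1n mul1r !mulr1 (low r rlt) addnn -mul2n => /eqP.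
  rewrite -subr_eq => /eqP <-; rewrite /be addnn -mul2n.
  by field; rewrite dr addrC natr1 char0.
have cr : scoef M r != 0 by rewrite low.
have c_lt t : (t < r)%N -> scoef M t = 0.
  by move=> tr; rewrite low ?d_lt // (ltn_trans tr).
have [|s /andP[sr cs] c_lts] := first_nz (scoef M) (fun t => t != r).
  move=> c0; apply: nonmono; exists r, (scoef M r), M; split=> //.
  exact: scoef_monomial.
have rs : (r < s)%N.
  by case: (ltngtP s r) sr cs => // sr _; rewrite c_lt ?eqxx.
have s2r : s != (2 * r)%N by apply: contraNneq cs => ->; rewrite c2r.
(* A diagonal change turns [c_m] into [ga c_m / al^(m+1)]. Value 1 at [r] fixes [ga], and value 1 at
   [s] then requires [al^(s-r) = c_s / c_r]. *)
have [al alE] : exists y, y ^+ (s - r) = scoef M s / scoef M r.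
  by apply: has_root; rewrite subn_gt0.
have {al0} al0 : al != 0.
  apply: contraNneq cs => alz; move/esym/eqP: alE.
  by rewrite alz expr0n subn_eq0 leqNgt rs mulf_eq0 invr_eq0 (negPf cr) orbF.
pose ga := al ^+ r.+1 / scoef M r.
have ga0 : ga != 0 by rewrite mulf_neq0 ?expf_neq0 ?invr_eq0.
have [M' [h [abM' MM' h_br [z0 z02 hz0] [h0 h1]]]] := change_basis 0 abM al0 ga0.
have h00 : h (e 0) 0 = al :> K by rewrite h0 !formalE !evecE mulr1 mulr0 addr0.
have h01 : h (e 0) 1 = 0 :> K by rewrite h0 !formalE !evecE mulr0 mul0r addr0.
have h11 : h (e 1) 1 = ga :> K by rewrite h1 !formalE !evecE mulr1.
have c'E m : scoef M' m = ga * scoef M m / al ^+ m.+1.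
  by rewrite -h11 (hom_diag abM' abM h_br z02 hz0 m h01) h00 mulfK ?expf_neq0.
have c'r : scoef M' r = 1 by rewrite c'E /ga divfK // divff ?expf_neq0.
exists r, s, M'; split=> //; split=> //; last exact: lie_isomorphic_trans MM'.
split=> //.
- rewrite c'E /ga -(subnKC (ltnW rs)) -addSn exprD alE subnKC ?(ltnW rs) //.
  by field; rewrite expf_neq0 // cs cr.
- by rewrite c'E c2r mulr0 mul0r.
- by move=> t ts tr; rewrite c'E c_lts ?mulr0 ?mul0r.
Qed.

End NormalForm.

Theorem theorem3p2 (R : realType) (L : infFiliform R[i]) :
  lie_solvable L -> ~ monomial_type L ->
  exists! rs : nat * nat,
    [/\ (1 <= rs.1)%N, (rs.1 < rs.2)%N, rs.2 != (2 * rs.1)%N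
      & exists (lam : nat -> R[i]) (M : infFiliform R[i]),
          normal_form M rs.1 rs.2 lam /\ lie_isomorphic L M].
Proof.
(* The complex numbers enter through characteristic zero and the existence of roots. *)
have char0 n : n.+1%:R != 0 :> R[i] by rewrite Num.Theory.pnatr_eq0.
have has_root n (x : R[i]) : (0 < n)%N -> exists y, y ^+ n = x.
  by move=> n0; eexists; exact: (Num.Theory.rootCK n0 x).
case/solvable_abelian_from => k /(abelian_from2 char0) abL nonmono.
have [r [s [M [r0 rs s2r [abM cM LM]]]]] :=
  normal_coefs_exist char0 has_root abL nonmono.
exists (r, s); split=> [|[r' s'] /= [r0' rs' s2r' [lam [N [NN LN]]]]].
  by split=> //; exists (scoef M), M; split=> //; exact: coefs_normal_form.
have [abN cN] := normal_form_coefs r0' rs' s2r' NN.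
have MN := lie_isomorphic_trans (lie_isomorphic_sym LM) LN.
exact: (normal_coefs_unique char0 abM abN MN r0 rs cM r0' rs' cN).
Qed.
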